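(* Each collectionwise normal $\aleph$-space possesses a binary $\sigma$-discrete closed $k$-network and hence is super.
   Context: A family $\mathcal N$ of subsets of a topological space $X$ is called: a $k$-network if for any open set $U\subset X$ and any compact set $K\subset U$ there exists a finite subfamily $\mathcal F\subset\mathcal N$ such that $K\subset\bigcup\mathcal F\subset U$; a closed $k$-network if it is a $k$-network and each $N\in\mathcal N$ is closed in $X$; linked if $A\cap B\neq\emptyset$ for any $A,B\in\mathcal N$; centered if $\bigcap\mathcal F\ne\emptyset$ for every finite nonempty subfamily $\mathcal F\subset\mathcal N$; binary if every linked subfamily of $\mathcal N$ is centered. A topological space is super if it possesses a binary closed $k$-network. A family of subsets of $X$ is discrete if every point of $X$ has a neighborhood meeting at most one member of the family, and $\sigma$-discrete if it is a countable union of discrete families. A regular (Hausdorff) space is an $\aleph$-space if it has a $\sigma$-discrete $k$-network. A $T_1$ space $X$ is collectionwise normal if for every discrete family $(F_s)_{s\in S}$ of closed subsets of $X$ there is a discrete family $(U_s)_{s\in S}$ of open subsets of $X$ with $F_s\subset U_s$ for all $s\in S$. *)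

(* Defs.v *)
From mathcomp Require Import all_boot all_order.
From mathcomp Require Import boolp classical_sets functions cardinality.
From mathcomp Require Import filter topology.

Set Implicit Arguments.
Unset Strict Implicit.
Unset Printing Implicit Defensive.

Local Open Scope classical_set_scope.

(* The case A = B is included, so members of a linked family are nonempty. *)
Definition linked {T : Type} (N : set (set T)) : Prop :=
  forall A B, N A -> N B -> A `&` B !=set0.

Definition centered {T : Type} (N : set (set T)) : Prop :=
  forall F : set (set T), finite_set F -> F !=set0 -> F `<=` N ->
    \bigcap_(A in F) A !=set0.

Definition binary {T : Type} (N : set (set T)) : Prop :=
  forall L : set (set T), L `<=` N -> linked L -> centered L.

Definition k_network {T : topologicalType} (N : set (set T)) : Prop :=
  forall U K : set T, open U -> compact K -> K `<=` U ->
    exists F : set (set T),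
      [/\ finite_set F, F `<=` N, K `<=` \bigcup_(A in F) A
        & \bigcup_(A in F) A `<=` U].

Definition closed_k_network {T : topologicalType} (N : set (set T)) : Prop :=
  k_network N /\ (forall A, N A -> closed A).

Definition super_space (T : topologicalType) : Prop :=
  exists N : set (set T), binary N /\ closed_k_network N.

(* The family (F i), i in S, is discrete; "at most one member" is counted by
   index. A set N of subsets of T is seen as a family indexed by itself:
   discrete_family N id. *)
Definition discrete_family {T : topologicalType} {I : Type} (S : set I)
    (F : I -> set T) : Prop :=
  forall x : T, exists2 V, nbhs x V &
    is_subset1 [set i | S i /\ V `&` F i !=set0].

Definition sigma_discrete {T : topologicalType} (N : set (set T)) : Prop :=
  exists D : nat -> set (set T),
    (forall n, discrete_family (D n) id) /\ N = \bigcup_n D n.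

Definition aleph_space (T : topologicalType) : Prop :=
  [/\ regular_space T, hausdorff_space T
    & exists N : set (set T), sigma_discrete N /\ k_network N].

(* accessible_space is the T1 axiom. *)
Definition collectionwise_normal (T : topologicalType) : Prop :=
  accessible_space T /\
  forall (I : Type) (S : set I) (F : I -> set T),
    (forall i, S i -> closed (F i)) -> discrete_family S F ->
    exists U : I -> set T,
      [/\ forall i, S i -> open (U i), discrete_family S U
        & forall i, S i -> F i `<=` U i].

(* Main.v *)
Require Import Defs.
From mathcomp Require Import all_boot all_order.
From mathcomp Require Import boolp classical_sets functions cardinality.
From mathcomp Require Import filter topology.

Set Implicit Arguments.
Unset Strict Implicit.
Unset Printing Implicit Defensive.

Local Open Scope classical_set_scope.

(** A finite set of pairwise intersecting pieces must be given a common point.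
    The network is built one discrete closed family at a time, and what has
    been built before each stage is a binary family BB of closed sets which is
    a union of finitely many discrete families. A member A of the next closed
    discrete family is not added itself; it is cut into closed pieces that
    cover it, lie in it, form finitely many discrete families, and leave BB
    together with the pieces binary ([binary_refinement]). Two members of the
    discrete family are disjoint, so a linked family meets the pieces of at
    most one of them, and they can be cut independently ([binary_extension]).
    Finitely many pieces of A cover a compact subset of A, so the union of all
    stages is a k-network because the closures of the given network form one.

    To cut A, let the type of a point be the finite set of members of BB that
    contain it, and let E b be the stratum of the points of A of type b. There
    is roughly one piece for each type b. It is a closed neighbourhood, in A, of
    the part of E b that is not yet covered by the pieces of larger types, so
    it meets only the members of BB that belong to b, and two pieces meet only
    if their types are comparable. Hence the types of a linked set of pieces
    form a chain c, and every member of BB that meets all of these pieces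
    belongs to the least type g of c. It is therefore enough that the pieces
    of c share a point of E g; pairwise intersections do not give such a point.

    The point is added by force. Each chain c from g to h receives its own mark
    x c in E g, which is thrown into all the pieces with type in c. Since
    distinct chains have distinct marks and the other pieces avoid x c, no
    unwanted intersection arises. There must be enough room for the
    marks in E g near the piece of h: an open set G h around that piece is
    chosen such that E g meets G h in an infinite set or not at all
    ([marked_step]). In the second case the pieces of g and h can be made
    disjoint ([fitted_step]) and no mark is needed.

    A type determines the set of those of the finitely many discrete families
    making up BB from which it has a member. For the types b with one such
    index set, the closed sets of the points of A whose type contains b form a
    discrete family. Numbering the index sets compatibly with inclusion
    ([finitely_discrete_code]) reduces both constructions to finitely many
    steps, and collectionwise normality performs each step for all types of one
    number at once. *)

(** * Discrete and locally finite families *)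

Definition locally_finite {X : topologicalType} {I : Type} (S : set I)
    (F : I -> set X) : Prop :=
  forall x : X, exists2 V, nbhs x V &
    finite_set [set i | S i /\ V `&` F i !=set0].

Section Families.
Variable X : topologicalType.

Lemma nbhs_setC (C : set X) (p : X) : closed C -> ~ C p -> nbhs p (~` C).
Proof.
by move=> clC nCp; apply: open_nbhs_nbhs; split=> //; exact: closed_openC.
Qed.

Lemma discrete_disjoint (I : Type) (S : set I) (F : I -> set X) i j p :
  discrete_family S F -> S i -> S j -> F i p -> F j p -> i = j.
Proof.
move=> /(_ p)[V Vp V1] Si Sj Fip Fjp; apply: V1; split=> //; exists p;
  by split=> //; exact: nbhs_singleton.
Qed.

Lemma discrete_sub (I : Type) (S S' : set I) (F F' : I -> set X) :
  discrete_family S F -> S' `<=` S -> (forall i, S' i -> F' i `<=` F i) ->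
  discrete_family S' F'.
Proof.
move=> dF SS FF x; have [V Vx V1] := dF x; exists V => // i j [Si [y [Vy Fy]]].
move=> [Sj [z [Vz Fz]]]; apply: V1; split; do ?exact: SS.
  by exists y; split=> //; exact: FF.
by exists z; split=> //; exact: FF.
Qed.

Lemma discrete_closure (I : Type) (S : set I) (F : I -> set X) :
  discrete_family S F -> discrete_family S (fun i => closure (F i)).
Proof.
move=> dF x; have [V Vx V1] := dF x.
exists (V°); first exact: nbhs_interior.
have key i : V° `&` closure (F i) !=set0 -> V `&` F i !=set0.
  by move=> [y [Vy clFy]]; have [z []] := clFy _ Vy; exists z.
by move=> i j [Si /key Vi] [Sj /key Vj]; exact: V1.
Qed.

Lemma discrete_image (I : Type) (S : set I) (F : I -> set X) :
  discrete_family S F -> discrete_family (F @` S) id.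
Proof.
move=> dF x; have [V Vx V1] := dF x; exists V => // A B [[i Si <-] Vi].
by move=> [[j Sj <-] Vj]; congr F; exact: V1.
Qed.

Lemma discrete_set0 (I : Type) (F : I -> set X) : discrete_family set0 F.
Proof. by move=> x; exists setT; [exact: filterT|move=> i j []]. Qed.

Lemma finite_is_subset1 (I : Type) (S : set I) : is_subset1 S -> finite_set S.
Proof.
move=> S1; have [[i Si]|/nonemptyPn ->] := pselect (S !=set0); last first.
  exact: finite_set0.
apply: (@sub_finite_set _ _ [set i]) => [j Sj|]; first exact: S1.
exact: finite_set1.
Qed.

Lemma discrete_locally_finite (I : Type) (S : set I) (F : I -> set X) :
  discrete_family S F -> locally_finite S F.
Proof.
move=> dF x; have [V Vx V1] := dF x.
by exists V => //; exact: finite_is_subset1.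
Qed.

Lemma locally_finite_sub (I : Type) (S S' : set I) (F F' : I -> set X) :
  locally_finite S F -> S' `<=` S -> (forall i, S' i -> F' i `<=` F i) ->
  locally_finite S' F'.
Proof.
move=> lF SS FF x; have [V Vx Vf] := lF x; exists V => //.
apply: sub_finite_set Vf => i [Si [y [Vy Fy]]]; split; first exact: SS.
by exists y; split=> //; exact: FF.
Qed.

Lemma locally_finiteU (I : Type) (S S' : set I) (F : I -> set X) :
  locally_finite S F -> locally_finite S' F -> locally_finite (S `|` S') F.
Proof.
move=> lS lS' x; have [V Vx Vf] := lS x; have [V' Vx' Vf'] := lS' x.
exists (V `&` V'); first exact: filterI.
have := conj Vf Vf'; rewrite -finite_setU.
apply: sub_finite_set => i [[Si|Si] [y [[Vy Vy'] Fy]]]; [left|right];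
  by split=> //; exists y.
Qed.

Lemma locally_finite_closed (I : Type) (S : set I) (F : I -> set X) :
  locally_finite S F -> (forall i, S i -> closed (F i)) ->
  closed (\bigcup_(i in S) F i).
Proof.
move=> lF clF p clp; have [V Vp Vf] := lF p.
pose J : set {classic I} := [set i | S i /\ V `&` F i !=set0].
have clJ : closed (\bigcup_(i in J) F i).
  by apply: closed_bigcup => // i [Si _]; exact: clF.
suff [i [Si _] Fi] : (\bigcup_(i in J) F i) p by exists i.
apply: clJ => W Wp.
have [q [[i Si Fiq] [Vq Wq]]] := clp _ (filterI Vp Wp).
by exists q; split=> //; exists i => //; split=> //; exists q.
Qed.

(** For closed sets, local finiteness and disjointness suffice: the members that
    miss a point have a closed union, which can be removed from the point's
    neighbourhood. *)
Lemma locally_finite_discrete (I : Type) (S : set I) (F : I -> set X) :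
  locally_finite S F -> (forall i, S i -> closed (F i)) ->
  (forall i j p, S i -> S j -> F i p -> F j p -> i = j) ->
  discrete_family S F.
Proof.
move=> lF clF dF p; have [V Vp Vf] := lF p.
pose C := \bigcup_(i in [set i | S i /\ ~ F i p]) F i.
have clC : closed C.
  apply: (@locally_finite_closed _ [set i | S i /\ ~ F i p] F).
    by apply: (locally_finite_sub lF) => [i []|i _ p0].

  by move=> i [Si _]; exact: clF.
have nCp : ~ C p by move=> [i [_ ?]].
exists (~` C); first exact: nbhs_setC.
have key i : S i -> ~` C `&` F i !=set0 -> F i p.
  by move=> Si [y [nCy Fy]]; apply: contrapT => nFi; apply: nCy; exists i.
by move=> i j [Si /(key _ Si) Fi] [Sj /(key _ Sj) Fj]; exact: dF Fi Fj.
Qed.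

(** Near-covering compactness, applied to the filter of the sets of index sets
    that contain all large enough finite index sets. *)
Lemma compact_locally_finite (I : Type) (S : set I) (F : I -> set X) K :
  compact K -> locally_finite S F ->
  finite_set [set i | S i /\ K `&` F i !=set0].
Proof.
move=> /compact_near_coveringP cK lF.
pose G := [set A : set (set I) | exists2 J : set I, finite_set J &
            forall J', finite_set J' -> J `<=` J' -> A J'].
have fG : Filter G.
  split.
  - by exists set0 => //; exact: finite_set0.
  - move=> P Q [J fJ JP] [J' fJ' JQ]; exists (J `|` J').
      by rewrite finite_setU.
    by move=> L fL; rewrite subUset => -[? ?]; split; [exact: JP|exact: JQ].
  - by move=> P Q PQ [J fJ JP]; exists J => // L ? ?; apply: PQ; exact: JP.
pose P (J : set I) x := forall i, S i -> F i x -> J i.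
have [|J fJ JK] := cK _ G P fG.
  move=> x Kx; have [V Vx Vf] := lF x.
  exists (V, [set J | [set i | S i /\ V `&` F i !=set0] `<=` J]) => /=.
    by split=> //; exists [set i | S i /\ V `&` F i !=set0].
  by move=> [y J] /= [Vy JV] i Si Fi; apply: JV; split=> //; exists y.
have {JK} JK := JK J fJ (fun _ => id).
by apply: sub_finite_set fJ => i [Si [y [Ky Fy]]]; exact: (JK y Ky i).
Qed.

Hypothesis cwnX : collectionwise_normal X.

Lemma finite_closed (A : set X) : finite_set A -> closed A.
Proof. by move: A; apply/accessible_finite_set_closed; case: cwnX. Qed.

(** Collectionwise normality contains normality: two disjoint closed sets form
    a discrete family. *)
Lemma closed_shrinking (C U : set X) : closed C -> open U -> C `<=` U ->
  exists W, [/\ open W, C `<=` W & closure W `<=` U].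
Proof.
move=> clC oU CU.
pose F (b : bool) := if b then C else ~` U.
have clF b : closed (F b) by case: b => //=; exact: open_closedC.
have [|V [oV dV FV]] := cwnX.2 bool setT F (fun b _ => clF b).
  apply: locally_finite_discrete => //.
  - by move=> x; exists setT; [exact: filterT|exact: finite_finset].
  - by move=> [] [] p _ _ //=; [move=> /CU Up nUp|move=> nUp /CU].
exists (V true); split; [exact: oV|exact: (FV true)|].
move=> p clp; apply: contrapT => nUp.
have Vp : V false p by apply: (FV false).
have [q [Vtq Vfq]] := clp _ (open_nbhs_nbhs (conj (oV false I) Vp)).
by have := discrete_disjoint (i := true) (j := false) dV I I Vtq Vfq.
Qed.

(** The last clause keeps neighbourhoods of the empty set empty. Thanks to it,
    a type whose stratum is already covered by the pieces of larger types gets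
    an empty neighbourhood, and its piece can be discarded. *)
Lemma discrete_expansion (I : Type) (S : set I) (T O : I -> set X) :
  (forall i, S i -> closed (T i)) -> discrete_family S T ->
  (forall i, S i -> open (O i)) -> (forall i, S i -> T i `<=` O i) ->
  exists W : I -> set X,
    [/\ forall i, S i -> open (W i), forall i, S i -> T i `<=` W i,
        forall i, S i -> closure (W i) `<=` O i,
        discrete_family S (fun i => closure (W i)) &
        forall i, S i -> closure (W i) !=set0 -> T i !=set0].
Proof.
move=> clT dT oO TO; have [U [oU dU TU]] := cwnX.2 I S T clT dT.
have /choice[W PW] i : exists W, S i -> [/\ open W, T i `<=` W,
    closure W `<=` U i `&` O i & closure W !=set0 -> T i !=set0].
  have [Si|nSi] := pselect (S i); last by exists set0.
  have [Tn0|/nonemptyPn Tn0] := pselect (T i !=set0); last first.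
    exists set0 => _; rewrite closure0 Tn0; split=> //; exact: open0.
  have [||W [oW TW WU]] := @closed_shrinking (T i) (U i `&` O i) (clT _ Si).
  - by apply: openI; [exact: oU|exact: oO].
  - by move=> p Tp; split; [exact: TU|exact: TO].
  by exists W.
exists W; split=> [i /PW[]//|i /PW[]//|i /PW[_ _ WUO _] p /WUO[]//||i /PW[]//].
by apply: discrete_sub dU _ _ => // i /PW[_ _ WUO _] p /WUO[].
Qed.

End Families.

(** * Marks for chains of types *)

Lemma finite_powerset (I : Type) (S : set I) :
  finite_set S -> finite_set [set R | R `<=` S].
Proof.
move=> /(@finite_seqP {classic I})[s ->]; elim: s => [|a s IHs].
  apply: (@sub_finite_set _ _ [set set0]); last exact: finite_set1.
  by move=> R /=; rewrite set_nil subset0.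
pose P := [set R | R `<=` [set` s]].
have fU : finite_set (P `|` (fun R => a |` R) @` P).
  by rewrite finite_setU; split=> //; exact: finite_image.
apply: sub_finite_set fU => R /= Ras.
have [Ra|nRa] := pselect (R a); last first.
  left=> b Rb; have := Ras _ Rb; rewrite /= inE => /orP[/eqP ba|//].
  by case: nRa; rewrite -ba.
right; exists (R `\ a); last exact: setD1K.
by move=> b [Rb ba]; have := Ras _ Rb; rewrite /= inE => /orP[/eqP|//].
Qed.

Lemma finite_into_infinite (U V : Type) (C : set U) (S : set V) :
  finite_set C -> infinite_set S ->
  exists f : U -> V, (forall c, C c -> S (f c)) /\
    (forall c c', C c -> C c' -> f c = f c' -> c = c').
Proof.
move=> /finite_set_countable/countable_injP[h hinj] /infiniteP/card_leP[g].
exists (fun c => \val (g (SigSub (mem_set (I : [set: nat] (h c)))))); split.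
  by move=> c _; apply: set_mem; exact: valP.
move=> c c' Cc Cc' /val_inj ghc.
have /(congr1 \val)/= hc := inj (mem_set I) (mem_set I) ghc.
by apply: hinj; rewrite ?inE.
Qed.

Section Types.
Variables (X : topologicalType) (BB : set (set X)) (A : set X).

Definition type_at (p : X) : set (set X) := [set B | BB B /\ B p].
Definition types : set (set (set X)) := type_at @` A.
Definition stratum (g : set (set X)) : set X := [set p | A p /\ type_at p = g].
Definition above (b : set (set X)) : set X := [set p | A p /\ b `<=` type_at p].

Hypothesis cwnX : collectionwise_normal X.
Hypothesis lfBB : locally_finite BB id.
Hypothesis clBB : forall B, BB B -> closed B.
Hypothesis clA : closed A.

Lemma ty_finite p : finite_set (type_at p).
Proof.
have [V Vp Vf] := lfBB p; apply: sub_finite_set Vf => B [BBB Bp]; split=> //.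
by exists p; split=> //; exact: nbhs_singleton.
Qed.

Lemma types_finite b : types b -> finite_set b.
Proof. by move=> [p _ <-]; exact: ty_finite. Qed.

Lemma types_sub b : types b -> b `<=` BB.
Proof. by move=> [p _ <-] B []. Qed.

Lemma above_closed b : types b -> closed (above b).
Proof.
move=> tb p clp; split; first by apply: clA => V /clp[q [[Aq _] Vq]]; exists q.
move=> B bB; split; first exact: types_sub bB.
apply: clBB; first exact: types_sub bB.
by move=> V /clp[q [[_ /(_ _ bB)[_ Bq]] Vq]]; exists q.
Qed.

(** For a set c of types that has a least and a greatest member, these are
    [bot c] and [top c]; this is how a chain refers to its ends. *)
Definition bot (c : set (set (set X))) : set (set X) := \bigcap_(d in c) d.
Definition top (c : set (set (set X))) : set (set X) := \bigcup_(d in c) d.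

(** The sets of types that receive a mark. Nothing is asked of the types
    strictly between the ends; the chains are selected among these sets in
    [good_chain]. *)
Definition spanning (S : set (set (set X))) (G : set (set X) -> set X)
    (c : set (set (set X))) : Prop :=
  [/\ c (bot c), c (top c), S (top c), bot c <> top c
    & stratum (bot c) `&` G (top c) !=set0].

(** The mark of c lies in the stratum of the least member of c, hence only in
    members of BB that belong to every member of c, and close to the greatest
    one, hence the marks form a locally finite set. *)
Record marked (S : set (set (set X))) (G : set (set X) -> set X)
    (x : set (set (set X)) -> X) : Prop := Marked {
  marked_open : forall b, S b -> open (G b);
  marked_above : forall b, S b -> above b `<=` G b;
  marked_lf : locally_finite S G;
  marked_in : forall c, spanning S G c -> (stratum (bot c) `&` G (top c)) (x c);
  marked_inj : forall c c', spanning S G c -> spanning S G c' ->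
    x c = x c' -> c = c' }.

(** A neighbourhood that meets finitely many sets [G b] contains few marks: the
    mark of c lies in [G (top c)], and c is a set of subsets of the finite set
    [top c]. *)
Lemma marks_closed S G x (Q : set (set (set (set X)))) :
  S `<=` types -> marked S G x -> Q `<=` spanning S G ->
  closed (\bigcup_(c in Q) [set x c]).
Proof.
move=> St mG QS; apply: (@locally_finite_closed _ _ Q (fun c => [set x c])).
  move=> p; have [V Vp Vf] := marked_lf mG p; exists V => //.
  pose J := \bigcup_(b in [set b | S b /\ V `&` G b !=set0])
    [set c : set (set (set X)) | c `<=` [set d | d `<=` b]].
  have fJ : finite_set J.
    apply: bigcup_finite => // b [Sb _].
    by do 2!apply: finite_powerset; exact/types_finite/St.
  apply: sub_finite_set fJ => c [/QS cS [y [/= Vx yE]]]; rewrite yE in Vx.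
  exists (top c); last by move=> d cd B dB; exists d.
  split; first by case: cS.
  by exists (x c); split=> //; case: (marked_in mG cS).
by move=> c _; apply: finite_closed => //; exact: finite_set1.
Qed.

(** The new neighbourhoods avoid the old marks, which form a closed set. This is
    possible except for the marks that lie in [above b], but these do not
    compete with new marks near b, which have types strictly smaller than b.
    From the neighbourhood of b the strata strictly below b that meet it in a
    finite set are then removed, so that any stratum strictly below b that
    still meets it offers infinitely many points, while only finitely many
    sets c have top b. *)
Lemma marked_step S S' G x : S `<=` types -> S' `<=` types ->
  (forall b, S b -> ~ S' b) -> discrete_family S' above -> marked S G x ->
  exists G' x', marked (S `|` S') G' x'.
Proof.
move=> St St' SS' dT mG.
pose Q b := [set c | spanning S G c /\ ~ above b (x c)].
pose P b := \bigcup_(c in Q b) [set x c].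
have clP b : closed (P b) by apply: (marks_closed St mG) => c [].
have [b|b _|b Sb p bp|W [oW TW WP dW _]] :=
    @discrete_expansion _ cwnX _ S' above (fun b => ~` P b) _ dT.
- by move=> /St'; exact: above_closed.
- exact: closed_openC.
- by move=> [c [_ nx] pE]; apply: nx; rewrite -pE.
(* Points of these strata could not be used as marks. Removing them keeps the
   neighbourhood open, since b has finitely many subsets. *)
pose bad b := [set p | W b p /\ [/\ A p, type_at p <> b, type_at p `<=` b
                & finite_set (stratum (type_at p) `&` W b)]].
have badf b : S' b -> finite_set (bad b).
  move=> Sb; have fb : finite_set (\bigcup_(g in [set g | g `<=` b /\
      finite_set (stratum g `&` W b)]) (stratum g `&` W b)).
    apply: bigcup_finite; last by move=> g [].
    apply: (@sub_finite_set _ _ [set g | g `<=` b]); first by move=> g [].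
    exact/finite_powerset/types_finite/St'.
  by apply: sub_finite_set fb => p [Wp [Ap _ pb fp]]; exists (type_at p).
pose N b := W b `\` bad b.
have Ninf g b : g `<=` b -> g <> b -> stratum g `&` N b !=set0 ->
    infinite_set (stratum g `&` N b).
  move=> gb gNb [p [[Ap tp] [Wp nbp]]].
  have iW : infinite_set (stratum g `&` W b).
    by move=> fW; apply: nbp; split=> //; rewrite tp.
  apply: (sub_infinite_set _ iW) => q [[Aq tq] Wq]; split=> //; split=> //.
  by move=> [_ [_ _ _ fW]]; apply: iW; rewrite -tq.
have /choice[f Pf] bg : exists f : set (set (set X)) -> X,
    S' bg.1 -> bg.2 `<=` bg.1 -> bg.2 <> bg.1 ->
    stratum bg.2 `&` N bg.1 !=set0 ->
    (forall c, c `<=` [set d | d `<=` bg.1] ->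
      (stratum bg.2 `&` N bg.1) (f c)) /\
    (forall c c', c `<=` [set d | d `<=` bg.1] ->
      c' `<=` [set d | d `<=` bg.1] -> f c = f c' -> c = c').
  have [Sb|] := pselect (S' bg.1); last by exists (fun c => x c).
  have [gb|] := pselect (bg.2 `<=` bg.1); last by exists (fun c => x c).
  have [gNb|] := pselect (bg.2 <> bg.1); last by exists (fun c => x c).
  have [E0|] := pselect (stratum bg.2 `&` N bg.1 !=set0); last first.
    by exists (fun c => x c).
  have fb := finite_powerset (finite_powerset (types_finite (St' _ Sb))).
  by have [f Hf] := finite_into_infinite fb (Ninf _ _ gb gNb E0); exists f.
pose G' b := if `[<S' b>] then N b else G b.
pose x' c := if `[<S' (top c)>] then f (top c, bot c) c else x c.
have GS b : S b -> G' b = G b by move=> /SS' nSb; rewrite /G' asboolF.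
have GS' b : S' b -> G' b = N b by move=> Sb; rewrite /G' asboolT.
have ctop c : c `<=` [set d | d `<=` top c].
  by move=> d cd B dB; exists d.
have old c : S (top c) -> spanning (S `|` S') G' c ->
    spanning S G c /\ x' c = x c.
  move=> St1 [c1 c2 _ c3]; rewrite GS // => c4; split=> //.
  by rewrite /x' asboolF //; exact: SS'.
have new c : S' (top c) -> spanning (S `|` S') G' c ->
    (stratum (bot c) `&` N (top c)) (x' c) /\
    (forall c', S' (top c') -> spanning (S `|` S') G' c' -> top c = top c' ->
       bot c = bot c' -> x' c = x' c' -> c = c').
  move=> St1 [c1 c2 _ c3]; rewrite GS' // => c4.
  have cb : bot c `<=` top c by move=> B /(_ _ c2).
  have [f1 f2] := Pf (top c, bot c) St1 cb c3 c4.
  rewrite /x' asboolT //; split; first exact: f1.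
  move=> c' St1' _ tc bc; rewrite asboolT // -tc -bc; apply: f2 => //.
  by rewrite /= tc.
(* A new mark lies in a neighbourhood that avoids the old marks, except those in
   [above (top c')]; but the new mark has type [bot c'], too small for that. *)
have oldnew c c' : S (top c) -> S' (top c') -> spanning (S `|` S') G' c ->
    spanning (S `|` S') G' c' -> x' c <> x' c'.
  move=> Sc Sc' oc oc' xx; have [sc xc] := old _ Sc oc.
  have [[[Ax tx] [Wx _]] _] := new _ Sc' oc'.
  have nP : ~ P (top c') (x' c') by apply: WP => //; exact: subset_closure.
  have [_ tops] : above (top c') (x' c').
    apply: contrapT => na; apply: nP; exists c; last by rewrite /= -xx xc.
    by split=> //; rewrite -xc xx.
  case: oc' => _ c2 _ + _; apply; apply/seteqP; split.
    by move=> B /(_ _ c2).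
  by rewrite -tx.
exists G', x'; split.
- move=> b [Sb|Sb]; first by rewrite GS //; exact: marked_open mG _ Sb.
  rewrite GS' // /N setDE; apply: openI; first exact: oW.
  by apply: closed_openC; exact: (finite_closed cwnX (badf _ Sb)).
- move=> b [Sb|Sb]; first by rewrite GS //; exact: marked_above mG _ Sb.
  rewrite GS' // => p bp; split; first exact: TW.
  move=> [_ [_ pb1 pb2 _]]; apply: pb1; apply/seteqP; split=> //.
  by case: bp.
- apply: locally_finiteU.
    by apply: locally_finite_sub (marked_lf mG) _ _ => // b Sb; rewrite GS.
  apply: locally_finite_sub (discrete_locally_finite dW) _ _ => // b Sb.
  by rewrite GS' // => p [Wp _]; exact: subset_closure.
- move=> c oc; have [_ _ [Sc|Sc] _ _] := oc.
    by have [sc ->] := old _ Sc oc; rewrite GS //; exact: marked_in mG _ sc.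
  by rewrite GS' //; case: (new _ Sc oc).
move=> c c' oc oc' xx; have [_ _ Sc _ _] := oc; have [_ _ Sc' _ _] := oc'.
case: Sc Sc' => Sc [] Sc'.
- have [sc xc] := old _ Sc oc; have [sc' xc'] := old _ Sc' oc'.
  by apply: (marked_inj mG) => //; rewrite -xc -xc'.
- by case: (oldnew _ _ Sc Sc' oc oc').
- by case: (oldnew _ _ Sc' Sc oc' oc).
have [[[_ t1] [W1 _]] fi] := new _ Sc oc.
have [[[_ t2] [W2 _]] _] := new _ Sc' oc'.
apply: fi => //; last by rewrite -t1 -t2 xx.
apply: (discrete_disjoint (p := x' c) dW) => //; first exact: subset_closure.
by rewrite xx; exact: subset_closure.
Qed.

Lemma marked0 x : marked set0 (fun _ => set0) x.
Proof.
split=> //.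
- move=> p; exists setT; first exact: filterT.
  by apply: sub_finite_set (finite_set0 _) => b [].
- by move=> c [].
- by move=> c c' [].
Qed.

Lemma marked_exists (code : set (set X) -> nat) (r : nat) (x0 : X) :
  (forall b, types b -> (code b < r)%N) ->
  (forall k, discrete_family [set b | types b /\ code b = k] above) ->
  exists G x, marked types G x.
Proof.
move=> codeP dT.
suff /(_ r)[G [x mG]] : forall k, exists G x,
    marked [set b | types b /\ (code b < k)%N] G x.
  exists G, x; congr (marked _ G x): mG; apply/seteqP.
  by split=> b; [case|move=> tb; split=> //; exact: codeP].
elim=> [|k [G [x mG]]].
  exists (fun _ => set0), (fun _ => x0).
  congr (marked _ _ _): (marked0 (fun _ => x0)).
  by apply/seteqP; split=> b [].
have [|||G' [x' mG']] := marked_step _ _ _ (dT k) mG.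
- by move=> b [].
- by move=> b [].
- by move=> b [_ bk] [_ bk']; move: bk; rewrite bk' ltnn.
exists G', x'; congr (marked _ G' x'): mG'; apply/seteqP; split=> b.
  by move=> [[tb bk]|[tb <-]]; split=> //; exact: ltnW.
move=> [tb]; rewrite ltnS leq_eqVlt => /orP[/eqP bk|bk]; by [right|left].
Qed.

(** * Closed pieces *)

(** The condition under which the pieces of b and of d, where b is included in
    d, are allowed to meet. When b and d are distinct, [stratum b] then has room
    for marks near the piece of d. *)
Definition nested (G : set (set X) -> set X) (b d : set (set X)) : Prop :=
  b `<=` d /\ stratum b `&` G d !=set0.

(** The pieces before the marks are added are the sets [closure (W b) `&` A];
    S is the set of the types treated so far. *)
Record fitted (G : set (set X) -> set X) (x : set (set (set X)) -> X)
    (S : set (set (set X))) (W : set (set X) -> set X) : Prop := Fitted {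
  fitted_open : forall b, S b -> open (W b);
  fitted_sub : forall b, S b -> closure (W b) `<=` G b;
  fitted_miss : forall b B p, S b -> BB B -> closure (W b) p -> B p -> b B;
  fitted_mark : forall b c, S b -> spanning types G c -> closure (W b) (x c) ->
    bot c = b;
  fitted_nested : forall b d p, S b -> S d -> A p -> closure (W b) p ->
    closure (W d) p -> [\/ b = d, nested G b d | nested G d b];
  fitted_cover : forall p, A p -> S (type_at p) -> exists2 d, S d & W d p;
  fitted_stratum : forall b, S b -> closure (W b) !=set0 ->
    W b `&` stratum b !=set0 }.

(** The types are treated from the largest ones down, so that the points of
    [above b] left uncovered have type exactly b. Such a point lies in none of
    the closed sets that the new neighbourhood must avoid: the members of BB
    outside b, the marks of other types, and the earlier pieces that the
    piece of b is not allowed to meet. *)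
Lemma fitted_step G x S S' W : S `<=` types -> S' `<=` types ->
  (forall b, S b -> ~ S' b) ->
  (forall b d, S' b -> types d -> b `<=` d -> b <> d -> S d) ->
  discrete_family S' above -> marked types G x -> fitted G x S W ->
  exists W', fitted G x (S `|` S') W'.
Proof.
move=> St St' SS' up dT mG fW.
pose Y b := above b `\` \bigcup_(d in S) W d.
have Ytype b p : S' b -> Y b p -> type_at p = b.
  move=> Sb [[Ap bp] nWp]; apply: contrapT => tpb.
  have Sp : S (type_at p) by apply: up Sb _ bp _; [exists p|move=> /esym].
  by have [d Sd Wp] := fitted_cover fW Ap Sp; apply: nWp; exists d.
have clY b : S' b -> closed (Y b).
  move=> Sb; rewrite /Y setDE; apply: closedI; first exact/above_closed/St'.
  apply: open_closedC; apply: bigcup_open => d Sd.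
  exact: fitted_open fW _ Sd.
pose C1 b := \bigcup_(B in [set B | BB B /\ ~ b B]) B.
pose C2 b :=
  \bigcup_(c in [set c | spanning types G c /\ bot c <> b]) [set x c].
pose C3 b :=
  \bigcup_(d in [set d | S d /\ ~ nested G b d]) (closure (W d) `&` A).
have clC1 b : closed (C1 b).
  apply: (@locally_finite_closed _ _ [set B | BB B /\ ~ b B] id).
    by apply: (locally_finite_sub lfBB) => [B []|B _ p].
  by move=> B [BBB _]; exact: clBB.
have clC2 b : closed (C2 b) by apply: (marks_closed _ mG) => // c [].
have clC3 b : closed (C3 b).
  apply: (@locally_finite_closed _ _ [set d | S d /\ ~ nested G b d]
    (fun d => closure (W d) `&` A)).
    apply: (locally_finite_sub (marked_lf mG)) => d []; first by move=> /St.
    by move=> Sd _ p [/(fitted_sub fW Sd)].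
  by move=> d _; apply: closedI => //; exact: closed_closure.
have [|b|b Sb p Yp|V [oV YV VO dV Vn0]] := @discrete_expansion _ cwnX _ S' Y
    (fun b => G b `&` (~` C1 b `&` (~` C2 b `&` ~` C3 b))) clY _ _ _.
- by apply: discrete_sub dT _ _ => // b _ p [].
- move=> Sb; apply: openI; first by apply: marked_open mG _ _; exact: St'.
  by do 2?apply: openI; exact: closed_openC.
- have tp := Ytype _ _ Sb Yp; have [[Ap bp] nWp] := Yp.
  split; first by apply: marked_above mG _ _ _ _ => //; exact: St'.
  split; first by move=> [B [BBB nbB] Bp]; apply: nbB; rewrite -tp.
  split.
    move=> [c [sc bc] pE]; apply: bc; rewrite -tp pE.
    by have [[_ ->]] := marked_in mG sc.
  move=> [d [Sd nbd] [Wp _]]; apply: nbd; split.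
    move=> B bB; apply: (fitted_miss fW Sd _ Wp); first by case: (bp _ bB).
    by case: (bp _ bB).
  by exists p; split=> //; exact: fitted_sub fW _ Sd _ Wp.
pose W' b := if `[<S' b>] then V b else W b.
have WS b : S b -> W' b = W b by move=> /SS' nSb; rewrite /W' asboolF.
have WS' b : S' b -> W' b = V b by move=> Sb; rewrite /W' asboolT.
have mix b d p : S b -> S' d -> A p -> closure (W b) p -> closure (V d) p ->
    nested G d b.
  move=> Sb Sd Ap Wp Vp; apply: contrapT => ndb.
  have [_ [_ [_ nC3]]] := VO _ Sd _ Vp.
  by apply: nC3; exists b.
exists W'; split.
- move=> b [Sb|Sb]; first by rewrite WS //; exact: fitted_open fW _ Sb.
  by rewrite WS' //; exact: oV.
- move=> b [Sb|Sb]; first by rewrite WS //; exact: fitted_sub fW _ Sb.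
  by rewrite WS' // => p /(VO _ Sb)[].
- move=> b B p [Sb|Sb] BBB.
    by rewrite WS // => Wp; exact: (fitted_miss fW Sb BBB Wp).
  rewrite WS' // => /(VO _ Sb)[_ [nC1 _]] Bp.
  by apply: contrapT => nb; apply: nC1; exists B.
- move=> b c [Sb|Sb] sc; first by rewrite WS //; exact: (fitted_mark fW Sb sc).
  rewrite WS' // => /(VO _ Sb)[_ [_ [nC2 _]]].
  by apply: contrapT => nb; apply: nC2; exists c.
- move=> b d p [Sb|Sb] [Sd|Sd] Ap.
  + by rewrite !WS //; exact: (fitted_nested fW Sb Sd Ap).
  + by rewrite WS // WS' // => Wp Vp; constructor 3; exact: mix Wp Vp.
  + by rewrite WS' // WS // => Vp Wp; constructor 2; exact: mix Wp Vp.
  + rewrite !WS' // => Vb Vd; constructor 1.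
    exact: (discrete_disjoint (p := p) dV).
- move=> p Ap Sp.
  have [[d Sd Wp]|nW] := pselect (exists2 d, S d & W d p).
    by exists d; [left|rewrite WS].
  case: Sp => Sp; first by case: nW; exact: (fitted_cover fW Ap Sp).
  exists (type_at p); first by right.
  by rewrite WS' //; apply: (YV _ Sp); split; [split=> //|exact: nW].
move=> b [Sb|Sb]; first by rewrite WS //; exact: (fitted_stratum fW Sb).
rewrite WS' // => /(Vn0 _ Sb)[p Yp]; exists p; split; first exact: YV.
by split; [case: Yp => [[]]|exact: Ytype Yp].
Qed.

Lemma fitted_exists (code : set (set X) -> nat) (r : nat) G x :
  (forall b, types b -> (code b < r)%N) ->
  (forall b d, types b -> types d -> b `<=` d -> b <> d ->
    (code b < code d)%N) ->
  (forall k, discrete_family [set b | types b /\ code b = k] above) ->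
  marked types G x -> exists W, fitted G x types W.
Proof.
move=> codeP mono dT mG.
suff /(_ r)[W fW] : forall k, exists W,
    fitted G x [set b | types b /\ (r <= code b + k)%N] W.
  exists W; congr (fitted G x _ W): fW; apply/seteqP.
  by split=> b; [case|move=> tb; split=> //; exact: leq_addl].
elim=> [|k [W fW]].
  exists (fun _ => set0).
  rewrite (_ : [set _ | _] = set0); first by split=> // b [].
  by apply/seteqP; split=> b // [tb]; rewrite addn0 leqNgt codeP.
have dT' : discrete_family [set b | types b /\ (code b + k.+1 = r)%N] above.
  apply: (discrete_sub (dT (r - k.+1)%N)) => [b [tb <-]|b _ p //].
  by split=> //; rewrite addnK.
have [|||b d [tb bk] td bd bNd|W' fW'] := fitted_step _ _ _ _ dT' mG fW.
- by move=> b [].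
- by move=> b [].
- by move=> b [_ bk] [_ bk']; move: bk; rewrite -bk' addnS ltnn.
- split=> //; rewrite -bk addnS -addSn leq_add2r.
  exact: mono.
exists W'; congr (fitted G x _ W'): fW'; apply/seteqP; split=> b.
  by move=> [[tb bk]|[tb <-]]; split=> //; rewrite addnS ltnW.
move=> [tb]; rewrite leq_eqVlt => /orP[/eqP bk|bk]; first by right.
by left; split=> //; rewrite -ltnS -addnS.
Qed.

(** * Adding the marks *)

Section Pieces.
Variables (G : set (set X) -> set X) (x : set (set (set X)) -> X).
Variable W : set (set X) -> set X.
Hypothesis mG : marked types G x.
Hypothesis fW : fitted G x types W.

(** The types of the pieces that are kept: those with a point of their own
    stratum in their piece, by [fitted_stratum]. *)
Definition live : set (set (set X)) :=
  [set b | types b /\ closure (W b) !=set0].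

(** Requiring all pairs of the chain to be nested, and not only its ends, makes
    [piece_nested] true: a mark only joins pieces that may meet. *)
Definition good_chain (c : set (set (set X))) : Prop :=
  spanning types G c /\
  forall b d, c b -> c d -> [\/ b = d, nested G b d | nested G d b].

Definition piece (b : set (set X)) : set X :=
  (closure (W b) `&` A) `|`
  \bigcup_(c in [set c | good_chain c /\ c b]) [set x c].

Lemma piece_closed b : closed (piece b).
Proof.
apply: closedU; first by apply: closedI => //; exact: closed_closure.
by apply: (marks_closed _ mG) => // c [[]].
Qed.

Lemma piece_sub b : piece b `<=` A.
Proof.
by move=> p [[]|[c [[sc _] _] ->]] //; case: (marked_in mG sc) => -[].
Qed.

Lemma piece_miss b B p : types b -> BB B -> piece b p -> B p -> b B.
Proof.
move=> tb BBB [[Wp _]|[c [[sc _] cb] ->]] Bp.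
  exact: (fitted_miss fW tb BBB Wp).
have [[_ tx] _] := marked_in mG sc.
have : bot c B by rewrite -tx.
by apply.
Qed.

(** A mark creates no intersection between pieces of types outside its chain: it
    belongs to no unmarked piece other than that of the least type of its chain,
    and different chains have different marks. *)
Lemma piece_nested b d p : types b -> types d -> piece b p -> piece d p ->
  [\/ b = d, nested G b d | nested G d b].
Proof.
move=> tb td [[Wb Ap]|[c [[sc lc] cb] pE]].
  move=> [[Wd _]|[c [[sc lc] cd] pE]].
    exact: (fitted_nested fW tb td Ap Wb Wd).
  rewrite pE in Wb; have bE := fitted_mark fW tb sc Wb.
  by apply: lc => //; rewrite -bE; case: sc.
move=> [[Wd _]|[c' [[sc' lc'] cd'] pE']].
  rewrite pE in Wd; have bE := fitted_mark fW td sc Wd.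
  by apply: lc => //; rewrite -bE; case: sc.
have cc : c = c' by apply: (marked_inj mG) => //; rewrite -pE -pE'.
by apply: lc => //; rewrite cc.
Qed.

Lemma piece_locally_finite : locally_finite types piece.
Proof.
move=> p; have [V Vp Vf] := marked_lf mG p; exists V => //.
pose J := \bigcup_(d in [set d | types d /\ V `&` G d !=set0])
  [set b : set (set X) | b `<=` d].
have fJ : finite_set J.
  by apply: bigcup_finite => // d [td _]; exact/finite_powerset/types_finite.
apply: sub_finite_set fJ => b [tb [q [Vq [[Wq _]|[c [[sc _] cb] qE]]]]].
  exists b => //; split=> //; exists q; split=> //.
  exact: fitted_sub fW _ tb _ Wq.
exists (top c); last by move=> B bB; exists b.
split; first by case: sc.
by exists q; split=> //; rewrite qE; case: (marked_in mG sc).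
Qed.

Lemma piece_cover p : A p -> exists2 b, live b & piece b p.
Proof.
move=> Ap; have [|b tb Wp] := fitted_cover fW Ap; first by exists p.
have clWp := subset_closure Wp.
by exists b; [split=> //; exists p|left].
Qed.

(** The types of the pieces in a linked family form a good chain. If it has one
    element b, any point of [stratum b] in the piece is common to all members;
    if it has more, the mark of the chain is. *)
Lemma pieces_binary (code : set (set X) -> nat) (r : nat) :
  (forall b, types b -> (code b < r)%N) ->
  (forall b d, types b -> types d -> b `<=` d -> b <> d ->
    (code b < code d)%N) ->
  binary BB -> binary (BB `|` piece @` live).
Proof.
move=> codeP mono binBB L LN linkL F fF F0 FL.
have linkF B C : F B -> F C -> B `&` C !=set0.
  by move=> FB FC; apply: linkL; exact: FL.
pose c := [set b | live b /\ F (piece b)].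
have Fcases B : F B -> BB B \/ exists2 b, c b & piece b = B.
  move=> FB; case: (LN _ (FL _ FB)) => [|[b lb bB]]; first by left.
  by right; exists b => //; split=> //; rewrite bB.
have ct b : c b -> types b by move=> [[]].
have cnest b d : c b -> c d -> [\/ b = d, nested G b d | nested G d b].
  move=> cb cd; have [p [bp dp]] := linkF _ _ cb.2 cd.2.
  exact: (piece_nested (ct _ cb) (ct _ cd) bp dp).
have cB b B : c b -> F B -> BB B -> b B.
  move=> cb FB BBB; have [p [bp Bp]] := linkF _ _ cb.2 FB.
  exact: (piece_miss (ct _ cb) BBB bp Bp).
have [[b0 cb0]|c0] := pselect (c !=set0); last first.
  apply: (binBB F) => // B /Fcases[//|[b cb _]]; by case: c0; exists b.
(* On a chain, inclusion is the order of the codes, which are bounded. *)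
have comp b d : c b -> c d -> (code b <= code d)%N -> b `<=` d.
  move=> cb cd bd; case: (cnest _ _ cb cd) => [->//|[]//|[db _]].
  have [-> //|dNb] := pselect (d = b).
  by move: (mono _ _ (ct _ cd) (ct _ cb) db dNb); rewrite ltnNge bd.
pose P n := `[<exists2 b, c b & code b = n>].
have exP : exists n, P n by exists (code b0); apply/asboolP; exists b0.
have [g cg gmin] : exists2 g, c g & forall b, c b -> g `<=` b.
  have [_ /asboolP[g cg <-] gmin] := ex_minnP exP; exists g => // b cb.
  by apply: comp => //; apply: gmin; apply/asboolP; exists b.
have [h ch hmax] : exists2 h, c h & forall b, c b -> b `<=` h.
  have [|_ /asboolP[h ch <-] hmax] := ex_maxnP (m := r) exP.
    by move=> _ /asboolP[b cb <-]; apply: ltnW; exact/codeP/ct.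
  exists h => // b cb.
  by apply: comp => //; apply: hmax; apply/asboolP; exists b.
have botE : bot c = g.
  by apply/seteqP; split=> [B /(_ _ cg)//|B gB b cb]; exact: gmin.
have topE : top c = h.
  by apply/seteqP; split=> [B [b cb bB]|B hB]; [exact: hmax bB|exists h].
have [gh|gNh] := pselect (g = h).
  have [p [Wp [Ap tp]]] := fitted_stratum fW (ct _ cg) cg.1.2.
  exists p => B FB; case: (Fcases _ FB) => [BBB|[b cb <-]].
    by have := cB _ _ cg FB BBB; rewrite -tp => -[].
  have -> : b = g by apply/seteqP; split; [rewrite gh; exact: hmax|exact: gmin].
  by left; split=> //; exact: subset_closure.
have sc : spanning types G c.
  split; rewrite ?botE ?topE //; first exact: ct.
  case: (cnest _ _ cg ch) => [//|[]//|[hg _]].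
  by case: gNh; apply/seteqP; split=> //; exact: gmin.
have [[Ax tx] _] := marked_in mG sc.
exists (x c) => B FB; case: (Fcases _ FB) => [BBB|[b cb <-]].
  by have := cB _ _ cg FB BBB; rewrite -botE -tx => -[].
by right; exists c.
Qed.

End Pieces.

(** Here [code] abstracts the only way in which the structure of BB as a finite
    union of discrete families matters. *)
Lemma binary_refinement (code : set (set X) -> nat) (r : nat) :
  (forall b, types b -> (code b < r)%N) ->
  (forall b d, types b -> types d -> b `<=` d -> b <> d ->
    (code b < code d)%N) ->
  (forall k, discrete_family [set b | types b /\ code b = k] above) ->
  binary BB ->
  exists N : nat -> set (set X),
    [/\ forall k, discrete_family (N k) id,
        forall k B, N k B -> [/\ (k < r)%N, closed B & B `<=` A],
        forall p, A p -> exists k B, N k B /\ B p &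
        binary (BB `|` \bigcup_k N k)].
Proof.
move=> codeP mono dT binBB.
have [[x0 Ax0]|A0] := pselect (A !=set0); last first.
  exists (fun _ => set0); split=> //.
  - by move=> k; exact: discrete_set0.
  - by move=> p Ap; case: A0; exists p.
  - by rewrite bigcup0 // setU0.
have [G [x mG]] := marked_exists x0 codeP dT.
have [W fW] := fitted_exists codeP mono dT mG.
exists (fun k => piece G x W @` [set b | live W b /\ code b = k]); split.
- move=> k; apply: discrete_image; apply: locally_finite_discrete.
  + have lf := piece_locally_finite mG fW.
    by apply: (locally_finite_sub lf) => [b [[]]|b _ q].
  + by move=> b _; exact: (piece_closed (W := W) mG).
  + move=> b d p [[tb _] bk] [[td _] dk] bp dp.
    have [//|[bd _]|[db _]] := piece_nested mG fW tb td bp dp.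
      apply: contrapT => bNd; have := mono _ _ tb td bd bNd.
      by rewrite bk dk ltnn.
    apply: contrapT => bNd; have := mono _ _ td tb db (fun e => bNd (esym e)).
    by rewrite bk dk ltnn.
- move=> k _ [b [[tb _] <-] <-]; split; first exact: codeP.
    exact: (piece_closed (W := W) mG).
  exact: (piece_sub mG).
- move=> p /(piece_cover fW)[b lb bp].
  by exists (code b), (piece G x W b); split=> //; exists b.
have -> : \bigcup_k piece G x W @` [set b | live W b /\ code b = k] =
    piece G x W @` live W.
  apply/seteqP; split=> [B [k _ [b [lb _] <-]]|B [b lb <-]]; first by exists b.
  by exists (code b) => //; exists b.
exact: pieces_binary codeP mono binBB.
Qed.

End Types.

(** * Finite unions of discrete families *)

Definition finitely_discrete (X : topologicalType) (BB : set (set X)) : Prop :=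
  exists (m : nat) (D : nat -> set (set X)),
    (forall i, discrete_family (D i) id) /\ BB = \bigcup_(i in `I_m) D i.

Section FinitelyDiscrete.
Variable X : topologicalType.

Lemma discrete_nbhs m (D : nat -> set (set X)) (p : X) :
  (forall i, discrete_family (D i) id) ->
  exists2 V, nbhs p V &
    forall i, (i < m)%N -> is_subset1 [set B | D i B /\ V `&` B !=set0].
Proof.
move=> dD; elim: m => [|m [V Vp IH]].
  by exists setT => //; exact: filterT.
have [V' Vp' V1] := dD m p; exists (V `&` V'); first exact: filterI.
move=> i; rewrite ltnS leq_eqVlt => /orP[/eqP ->|im] B C [DB [y [[Vy Vy'] By]]].
  by move=> [DC [z [[Vz Vz'] Cz]]]; apply: V1; split=> //; [exists y|exists z].
move=> [DC [z [[Vz Vz'] Cz]]]; apply: (IH i im); split=> //.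
  by exists y.
by exists z.
Qed.

Lemma finitely_discrete_lf (BB : set (set X)) :
  finitely_discrete BB -> locally_finite BB id.
Proof.
move=> [m [D [dD ->]]] p; have [V Vp V1] := discrete_nbhs m p dD.
exists V => //.
have fV : finite_set (\bigcup_(i in `I_m) [set B | D i B /\ V `&` B !=set0]).
  apply: bigcup_finite => [|i im]; first exact: finite_II.
  exact/finite_is_subset1/V1.
by apply: sub_finite_set fV => B [[i im DB] VB]; exists i.
Qed.

(** The code numbers the set of indices i such that b has a member in the i-th
    discrete family: first by size, then arbitrarily among the index sets of
    the same size. A type contains at most one member of each discrete family,
    so a strictly larger type has a strictly larger index set; and two types
    with the same index set that are both present near a point coincide. *)
Lemma finitely_discrete_code (BB : set (set X)) : finitely_discrete BB ->
  exists (code : set (set X) -> nat) (r : nat), forall A : set X,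
  [/\ forall b, types BB A b -> (code b < r)%N,
      forall b d, types BB A b -> types BB A d -> b `<=` d -> b <> d ->
        (code b < code d)%N &
      forall k, discrete_family [set b | types BB A b /\ code b = k]
        (above BB A)].
Proof.
move=> [m [D [dD BBE]]].
pose idx (b : set (set X)) : {set 'I_m} :=
  [set i : 'I_m | `[< exists2 B, D i B & b B >]]%SET.
pose K := #|{: {set 'I_m}}|.
pose code b := (#|idx b| * K + enum_rank (idx b))%N.
have idxP b (i : 'I_m) : (i \in idx b) <-> exists2 B, D i B & b B.
  by rewrite inE; split=> [/asboolP|?] //; exact/asboolP.
exists code, (m.+1 * K)%N => A; split.
- move=> b _; rewrite /code mulSn addnC.
  apply: (@leq_trans (K + #|idx b| * K)); first by rewrite ltn_add2r.
  by rewrite leq_add2l leq_mul2r -[X in (_ <= X)%N]card_ord max_card orbT.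
- move=> b d tb [q Aq tq] bd bNd.
  suff idxlt : idx b \proper idx d.
    rewrite /code; apply: (@leq_trans (#|idx b|.+1 * K)).
      by rewrite mulSn addnC ltn_add2r.
    apply: leq_trans (leq_addr _ _); rewrite leq_mul2r proper_card ?orbT //.
  apply/properP; split.
    apply/fintype.subsetP => i /idxP[B DB bB]; apply/idxP.
    by exists B => //; exact: bd.
  have [B dB nbB] : exists2 B, d B & ~ b B.
    apply: contrapT => nB; apply: bNd; apply/seteqP; split=> // B dB.
    by apply: contrapT => nbB; apply: nB; exists B.
  have : BB B by move: dB; rewrite -tq => -[].
  rewrite BBE => -[i im DB]; exists (Ordinal im); first by apply/idxP; exists B.
  apply/negP => /idxP[C DC bC]; apply: nbB.
  have dC := bd _ bC; move: dB dC; rewrite -tq => -[_ Bq] [_ Cq].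
  by rewrite (discrete_disjoint (p := q) (dD i) DB DC Bq Cq).
move=> k p; have [V Vp V1] := discrete_nbhs m p dD; exists V => //.
have sub b d q q' : types BB A b -> idx b = idx d -> V q -> V q' ->
    above BB A b q -> above BB A d q' -> b `<=` d.
  move=> [q0 _ tb] bd Vq Vq' [_ bq] [_ dq'] B bB.
  have : BB B by move: bB; rewrite -tb => -[].
  rewrite BBE => -[i im DB].
  have : Ordinal im \in idx d by rewrite -bd; apply/idxP; exists B.
  move=> /idxP[C DC dC].
  suff -> : B = C by [].
  apply: (V1 i im); split=> //.
    by exists q; split=> //; case: (bq _ bB).
  by exists q'; split=> //; case: (dq' _ dC).
move=> b d [[tb bk] [q [Vq bq]]] [[td dk] [q' [Vq' dq']]].
have bd : idx b = idx d.
  have : (code b %% K = code d %% K)%N by rewrite bk dk.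
  rewrite /code !modnMDl !modn_small ?ltn_ord // => bd.
  exact/enum_rank_inj/val_inj.
apply/seteqP; split; first exact: sub tb bd Vq Vq' bq dq'.
exact: sub td (esym bd) Vq' Vq dq' bq.
Qed.

Lemma finitely_discreteU (BB : set (set X)) (N : nat -> set (set X)) r :
  finitely_discrete BB -> (forall k, discrete_family (N k) id) ->
  (forall k B, N k B -> (k < r)%N) -> finitely_discrete (BB `|` \bigcup_k N k).
Proof.
move=> [m [D [dD ->]]] dN Nr.
exists (m + r)%N, (fun i => if (i < m)%N then D i else N (i - m)%N); split.
  by move=> i; case: ifP.
apply/seteqP; split=> [B [[i im DB]|[k _ NB]]|B [i /= imr]].
- exists i; first exact: ltn_addr.
  by move: im => /= ->.
- exists (m + k)%N; first by rewrite /= ltn_add2l (Nr _ _ NB).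
  by rewrite ltnNge leq_addr /= addKn.
case: ifP => im DB; first by left; exists i.
by right; exists (i - m)%N.
Qed.

Hypothesis cwnX : collectionwise_normal X.

(** * The network *)

(** A linked family in which some member is a piece of A outside BB contains no
    piece of another member of D, since that piece would be disjoint from it. So
    binarity has only to be checked for BB and the pieces of A. *)
Lemma binary_extension (BB D : set (set X)) :
  finitely_discrete BB -> (forall B, BB B -> closed B) -> binary BB ->
  discrete_family D id -> (forall A, D A -> closed A) ->
  exists BB', [/\ BB `<=` BB', finitely_discrete BB',
    forall B, BB' B -> closed B, binary BB' &
    forall A p, D A -> A p -> exists2 B, BB' B & B p /\ B `<=` A].
Proof.
move=> fBB clBB binBB dD clD.
have lfBB := finitely_discrete_lf fBB.
have [code [r codeP]] := finitely_discrete_code fBB.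
have /choice[N PN] A : exists N : nat -> set (set X), D A ->
    [/\ forall k, discrete_family (N k) id,
        forall k B, N k B -> [/\ (k < r)%N, closed B & B `<=` A],
        forall p, A p -> exists k B, N k B /\ B p &
        binary (BB `|` \bigcup_k N k)].
  have [DA|nDA] := pselect (D A); last by exists (fun _ => set0).
  have [c1 c2 c3] := codeP A.
  have [N PN] := binary_refinement cwnX lfBB clBB (clD _ DA) c1 c2 c3 binBB.
  by exists N.
pose N' k := \bigcup_(A in D) N A k.
have N'P k B : N' k B -> [/\ (k < r)%N, closed B & exists2 A, D A & B `<=` A].
  move=> [A DA NB]; have [_ /(_ _ _ NB)[kr cB BA] _ _] := PN _ DA.
  by split=> //; exists A.
have dN' k : discrete_family (N' k) id.
  move=> p; have [V Vp V1] := dD p.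
  have [[A0 [DA0 VA0]]|nA] := pselect (exists A, D A /\ V `&` A !=set0);
    last first.
    exists V => // B C [[A DA NB] [q [Vq Bq]]] _; case: nA; exists A.
    split=> //.
    have [_ /(_ _ _ NB)[_ _ BA] _ _] := PN _ DA.
    by exists q; split=> //; exact: BA.
  have [dN _ _ _] := PN _ DA0; have [V' Vp' V1'] := dN k p.
  exists (V `&` V'); first exact: filterI.
  have key B : N' k B -> V `&` V' `&` B !=set0 -> N A0 k B /\ V' `&` B !=set0.
    move=> [A DA NB] [q [[Vq Vq'] Bq]].
    have [_ /(_ _ _ NB)[_ _ BA] _ _] := PN _ DA.
    have <- : A = A0 by apply: V1; split=> //; exists q; split=> //; exact: BA.
    by split=> //; exists q.
  by move=> B C [NB VB] [NC VC]; apply: V1'; exact: key.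
exists (BB `|` \bigcup_k N' k); split.
- by move=> B BBB; left.
- by apply: (finitely_discreteU (r := r) fBB dN') => k B /N'P[].
- by move=> B [/clBB|[k _ /N'P[]]].
- move=> L LN linkL F fF F0 FL.
  have linkF : linked F by move=> B C FB FC; apply: linkL; exact: FL.
  have [FBB|nFBB] := pselect (F `<=` BB); first exact: binBB linkF _ fF F0 _.
  have [B0 FB0 nBB0] : exists2 B, F B & ~ BB B.
    apply: contrapT => nB; apply: nFBB => B FB.
    by apply: contrapT => nBBB; apply: nB; exists B.
  have [//|[k0 _ [A DA NB0]]] := LN _ (FL _ FB0).
  have [_ NA _ binA] := PN _ DA.
  have B0A : B0 `<=` A by case: (NA _ _ NB0).
  apply: (binA F) => // B FB.
  case: (LN _ (FL _ FB)) => [|[k _ [A' DA' NB]]]; first by left.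
  right; exists k => //.
  have [_ /(_ _ _ NB)[_ _ BA] _ _] := PN _ DA'.
  have [q [Bq B0q]] := linkF _ _ FB FB0.
  by rewrite (discrete_disjoint (p := q) dD DA DA' (B0A _ B0q) (BA _ Bq)).
move=> A p DA Ap; have [_ NA /(_ _ Ap)[k [B [NB Bp]]] _] := PN _ DA.
exists B; first by right; exists k => //; exists A.
by split=> //; case: (NA _ _ NB).
Qed.

End FinitelyDiscrete.

Lemma finite_sub_bigcup (T : Type) (F : nat -> set T) (S : set T) :
  (forall n m, (n <= m)%N -> F n `<=` F m) -> finite_set S ->
  S `<=` \bigcup_n F n -> exists n, S `<=` F n.
Proof.
move=> homoF /(@finite_seqP {classic T})[s ->]; elim: s => [|a s IHs] sF.
  by exists 0%N; rewrite set_nil.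
have [|n sn] := IHs; first by move=> b /= bs; apply: sF; rewrite /= inE bs orbT.
have [|m _ am] := sF a; first by rewrite /= inE eqxx.
exists (maxn n m) => b /=; rewrite inE => /orP[/eqP ->|bs].
  by apply: homoF am; exact: leq_maxr.
by apply: homoF (sn _ bs); exact: leq_maxl.
Qed.

Lemma sigma_discrete_bigcup (X : topologicalType) (BB : nat -> set (set X)) :
  (forall n, finitely_discrete (BB n)) -> sigma_discrete (\bigcup_n BB n).
Proof.
move=> /choice[m /choice[D DP]].
exists (fun k => if unpickle k is Some ni then
  if (ni.2 < m ni.1)%N then D ni.1 ni.2 else set0 else set0); split.
  move=> k; case: (unpickle k) => [[n i] /=|]; last exact: discrete_set0.
  by case: ifP => _; [case: (DP n)|exact: discrete_set0].
apply/seteqP; split=> B [n _].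
  have [_ ->] := DP n; move=> [i /= im DB].
  by exists (pickle (n, i)) => //; rewrite pickleK /= im.
case: (unpickle n) => [[n' i] /=|//]; case: ifP => // im DB.
by exists n' => //; have [_ ->] := DP n'; exists i.
Qed.

Theorem theorem3 (X : topologicalType)
    (cwnX : collectionwise_normal X) (alephX : aleph_space X) :
  (exists N : set (set X),
     [/\ binary N, sigma_discrete N & closed_k_network N])
  /\ super_space X.
Proof.
suff [N [binN sdN ckN]] : exists N : set (set X),
    [/\ binary N, sigma_discrete N & closed_k_network N].
  by split; exists N.
have [_ hX [N0 [[D0 [dD0 N0E]] kN0]]] := alephX.
pose inv (BB : set (set X)) :=
  [/\ finitely_discrete BB, forall B, BB B -> closed B & binary BB].
have inv0 : inv set0.
  split=> //; last by move=> L L0 _ F _ [B FB] /(_ _ FB)/L0.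
  exists 0%N, (fun _ => set0); split; first by move=> i; exact: discrete_set0.
  by rewrite II0 bigcup_set0.
have /choice[next nextP] (nBB : nat * set (set X)) : exists BB' : set (set X),
    inv nBB.2 -> [/\ nBB.2 `<=` BB', inv BB' &
      forall A p, D0 nBB.1 A -> closure A p ->
        exists2 B, BB' B & B p /\ B `<=` closure A].
  case: nBB => n BB /=.
  have [[fBB clBB binBB]|ninv] := pselect (inv BB); last by exists set0.
  have [|BB' [BBS fBB' clBB' binBB' covBB']] :=
    binary_extension cwnX fBB clBB binBB
      (discrete_image (discrete_closure (dD0 n))).
    by move=> B [A _ <-]; exact: closed_closure.
  by exists BB' => _; split=> // A p DA; apply: covBB'; exists A.
pose BBs := fix BBs n := if n is n'.+1 then next (n', BBs n') else set0.
have BBsP n : inv (BBs n).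
  by elim: n => [|n IHn] //=; have [] := nextP (n, BBs n) IHn.
have homoBBs n m : (n <= m)%N -> BBs n `<=` BBs m.
  move=> nm; rewrite -(subnKC nm).
  elim: (m - n)%N => [|k IHk]; first by rewrite addn0.
  rewrite addnS /=; have [sub _ _] := nextP ((n + k)%N, BBs (n + k)%N) (BBsP _).
  by apply: subset_trans IHk _; exact: sub.
exists (\bigcup_n BBs n); split.
- move=> L LN linkL F fF F0 FL.
  have [|n FBB] := finite_sub_bigcup homoBBs fF.
    exact: subset_trans FL LN.
  have [_ _ binn] := BBsP n.
  by apply: (binn F) => // B C FB FC; apply: linkL; exact: FL.
- by apply: sigma_discrete_bigcup => n; have [] := BBsP n.
split; last by move=> A [n _]; have [_ clBB _] := BBsP n; exact: clBB.
move=> U K oU cK KU.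
have [W [oW KW WU]] := closed_shrinking cwnX (compact_closed hX cK) oU KU.
have [F [fF FN KF FW]] := kN0 W K oW cK KW.
have /choice[n nP] A : exists n, F A -> D0 n A.
  have [FA|] := pselect (F A); last by exists 0%N.
  by have := FN _ FA; rewrite N0E => -[n _ DA]; exists n.
exists (\bigcup_(A in F)
  [set B | (BBs (n A).+1 B /\ K `&` B !=set0) /\ B `<=` closure A]); split.
- apply: bigcup_finite => // A _; have [fBB _ _] := BBsP (n A).+1.
  apply: sub_finite_set (compact_locally_finite cK (finitely_discrete_lf fBB)).
  by move=> B [].
- by move=> B [A _ [[BB _] _]]; exists (n A).+1.
- move=> p Kp; have [A FA Ap] := KF _ Kp.
  have [_ _ cov] := nextP (n A, BBs (n A)) (BBsP _).
  have [B BB [Bp BA]] := cov A p (nP _ FA) (subset_closure Ap).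
  by exists B => //; exists A => //; split=> //; split=> //; exists p.
move=> p [B [A FA [_ BA]] Bp]; apply: WU.
by apply: closureS (BA _ Bp) => q Aq; apply: FW; exists A.
Qed.
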